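(* $$10\sqrt[3]{2} = \sum_{k=0}^{\infty}\left(-\frac14\right)^{k}\frac{\left(\frac1{12}\right)_k\left(\frac7{12}\right)_k\left(\frac23\right)_k}{\left(\frac{11}{12}\right)_k(1)_k\left(\frac{17}{12}\right)_k}\,(60k+13).$$
   Context: For $k\in\mathbb{N}_0$, $(\alpha)_k=\alpha(\alpha+1)\cdots(\alpha+k-1)$ is the rising factorial (Pochhammer symbol), with $(\alpha)_0=1$. *)

(* Defs.v *)
From Stdlib Require Import Reals.
Open Scope R_scope.

(* (a)_k is the rising factorial here, not the falling one. *)
Fixpoint pochhammer (a : R) (k : nat) : R :=
  match k with
  | O => 1
  | S j => pochhammer a j * (a + INR j)
  end.

(* Main.v *)
Require Import Defs.
From Stdlib Require Import Reals Lra Lia.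
From Coquelicot Require Import Coquelicot.
Open Scope R_scope.

(** Since [(1/12)_k (7/12)_k / ((11/12)_k (17/12)_k) = (1/6)_{2k} / (11/6)_{2k}] is the ratio of
    the moment of [t^{2k}] to that of [1] for the weight [t^(-5/6) (1-t)^(2/3)] on [[0,1]],
    the binomial series turns the sum, times [B(1/6,5/3)], into
    [4^(2/3) \int_0^1 t^(-5/6) (1-t)^(2/3) (52 - 27 t^2) (4 + t^2)^(-5/3) dt].
    Modulo the exact form [30 d(t^(1/6) (1-t)^(2/3) (4+t^2)^(-2/3))] the integrand is
    [4 t^(-5/6) (1-t)^(-1/3) (4+t^2)^(-2/3) (2+3t)], and the algebraic substitution
    [z / (1+z)^2 = t / (t^2-t+2)^2], which fixes 0 and 1, carries
    [z^(-5/6) (1-z)^(-1/3) dz] to exactly one quarter of it. Hence the integral equals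
    [4 B(1/6,2/3) = 5 B(1/6,5/3)], and [5 * 4^(2/3) = 10 * 2^(1/3)].

    The endpoint singularities are removed by [t = 1 - (1 - s^6)^3]: then
    [1 - t = (1 - s^6)^3] and [t = s^6 (3 - 3 s^6 + s^12)] with a positive cofactor, so that
    both [t^(1/6)] and [(1-t)^(1/3)] are smooth in [s]. *)

(** * Smooth parametrization of the unit interval and its weight *)

Definition cof (s : R) : R := 3 - 3 * s ^ 6 + s ^ 12.
Definition par (s : R) : R := 1 - (1 - s ^ 6) ^ 3.
(* [wgt s ds = t^(-5/6) (1-t)^(-1/3) dt] for [t = par s] *)
Definition wgt (s : R) : R := 18 * (1 - s ^ 6) * Rpower (cof s) (- (5 / 6)).

Lemma cof_pos (s : R) : 0 < cof s.
Proof. unfold cof. replace (s ^ 12) with (s ^ 6 * s ^ 6) by ring.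
  pose proof (Rle_0_sqr (s ^ 6 - 3 / 2)). unfold Rsqr in *. lra. Qed.

Lemma par_cof (s : R) : par s = s ^ 6 * cof s.
Proof. unfold par, cof. ring. Qed.

Lemma Rpower_pos (x a : R) : 0 < Rpower x a.
Proof. apply exp_pos. Qed.

Lemma Rpower_succ (x a : R) : 0 < x -> Rpower x (a + 1) = x * Rpower x a.
Proof. intros Hx. rewrite Rpower_plus, Rpower_1 by exact Hx. ring. Qed.

Lemma is_derive_Rpower_comp (f : R -> R) (df a x : R) :
  0 < f x -> is_derive f x df ->
  is_derive (fun y => Rpower (f y) a) x (a * df * Rpower (f x) (a - 1)).
Proof.
  intros Hf Hd.
  replace (a * df * Rpower (f x) (a - 1)) with (df * (a * Rpower (f x) (a - 1))) by ring.
  apply (is_derive_comp (fun y => Rpower y a) f); [|exact Hd].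
  apply is_derive_Reals. now apply derivable_pt_lim_power.
Qed.

Lemma ex_derive_Rpower_comp (f : R -> R) (a x : R) :
  0 < f x -> ex_derive f x -> ex_derive (fun y => Rpower (f y) a) x.
Proof.
  intros Hf [df Hd]. eexists. now apply is_derive_Rpower_comp with (df := df).
Qed.

Lemma is_derive_par (s : R) : is_derive par s (18 * s ^ 5 * (1 - s ^ 6) ^ 2).
Proof. unfold par. auto_derive; [exact I|]. simpl. ring. Qed.

Lemma ex_derive_wgt (s : R) : ex_derive wgt s.
Proof.
  unfold wgt. apply ex_derive_mult; [auto_derive; exact I|].
  apply ex_derive_Rpower_comp; [apply cof_pos|]. unfold cof. auto_derive; exact I.
Qed.

Lemma continuous_wgt (s : R) : continuous wgt s.
Proof. apply (ex_derive_continuous (V := R_NormedModule)), ex_derive_wgt. Qed.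

Lemma continuous_par (s : R) : continuous par s.
Proof. apply (ex_derive_continuous (V := R_NormedModule)). eexists. apply is_derive_par. Qed.

Lemma par_range (s : R) : 0 <= s <= 1 -> 0 <= par s <= 1.
Proof.
  intros Hs. assert (H : 0 <= s ^ 6 <= 1).
  { split; [apply pow_le; lra|]. rewrite <- (pow1 6). apply pow_incr; lra. }
  assert (H3 : 0 <= (1 - s ^ 6) ^ 3 <= 1).
  { split; [apply pow_le; lra|]. rewrite <- (pow1 3). apply pow_incr; lra. }
  unfold par. lra.
Qed.

Lemma wgt_nonneg (s : R) : 0 <= s <= 1 -> 0 <= wgt s.
Proof.
  intros Hs. assert (H : s ^ 6 <= 1).
  { rewrite <- (pow1 6). apply pow_incr; lra. }
  unfold wgt. pose proof (Rpower_pos (cof s) (- (5/6))). nra.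
Qed.

(* In the variable [t = par s] the integrand is the exact form
   [d (t^(1/6) (1-t)^(2/3) h(t))]. *)
Lemma is_RInt_exact (h dh : R -> R) :
  (forall t, is_derive h t (dh t)) -> (forall t, continuous dh t) ->
  is_RInt (fun s => wgt s * ((1 - par s) / 6 * h (par s) - 2 / 3 * par s * h (par s)
                             + par s * (1 - par s) * dh (par s))) 0 1 0.
Proof.
  intros Hh Hdh.
  (* On [0,1] this is [t^(1/6) (1-t)^(2/3) h(t)], since [t^(1/6) = s * cof^(1/6)] and
     [(1-t)^(2/3) = (1-s^6)^2]. The factors [s] and [1 - s^6] make it vanish at both ends, so the
     integral is 0. *)
  set (F := fun s => s * Rpower (cof s) (1 / 6) * (1 - s ^ 6) ^ 2 * h (par s)).
  replace 0 with (F 1 - F 0) at 2 by (unfold F; ring).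
  apply (is_RInt_derive F).
  - intros s _. unfold F.
    assert (Hc : is_derive cof s (- 18 * s ^ 5 + 12 * s ^ 11)).
    { unfold cof. auto_derive; [exact I|]. simpl. ring. }
    assert (Hp := is_derive_Rpower_comp cof _ (1 / 6) s (cof_pos s) Hc).
    assert (Hhp := is_derive_comp h par s _ _ (Hh (par s)) (is_derive_par s)).
    assert (H1 : is_derive (fun s : R => s * (1 - s ^ 6) ^ 2) s
                  ((1 - s ^ 6) ^ 2 - 12 * s ^ 6 * (1 - s ^ 6))).
    { auto_derive; [exact I|]. simpl. ring. }
    assert (H2 := is_derive_mult _ _ s _ _ H1 Hp Rmult_comm).
    assert (H3 := is_derive_mult _ _ s _ _ H2 Hhp Rmult_comm).
    eapply is_derive_ext; [|evar_last; [exact H3|]].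
    + intros y. simpl. unfold mult; simpl. ring.
    + unfold plus, mult, scal; simpl. unfold mult; simpl.
      (* Only one power of [cof s] is left after this; once it is generalized, the goal is a
         rational identity in [s]. *)
      replace (Rpower (cof s) (1 / 6)) with (cof s * Rpower (cof s) (- (5 / 6)))
        by (rewrite <- Rpower_succ by apply cof_pos; f_equal; lra).
      replace (1 / 6 - 1) with (- (5 / 6)) by lra.
      unfold wgt. generalize (Rpower (cof s) (- (5 / 6))); intros p.
      generalize (h (par s)) (dh (par s)); intros a b. unfold par, cof. field.
  - intros s _. apply (continuous_mult wgt); [apply continuous_wgt|].
    assert (Hc : continuous (fun s => h (par s)) s).
    { apply continuous_comp; [apply continuous_par|].
      apply (ex_derive_continuous (V := R_NormedModule)). now exists (dh (par s)). }
    assert (Hd : continuous (fun s => dh (par s)) s).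
    { apply continuous_comp; [apply continuous_par|apply Hdh]. }
    assert (Hq : forall g : R -> R, (forall t, ex_derive g t) -> continuous (fun s => g (par s)) s).
    { intros g Hg. apply continuous_comp; [apply continuous_par|].
      now apply (ex_derive_continuous (V := R_NormedModule)). }
    apply (continuous_plus (V := R_NormedModule)); [apply (continuous_minus (V := R_NormedModule))|].
    + apply (continuous_mult (fun s => (1 - par s) / 6) (fun s => h (par s))); [|exact Hc].
      apply (Hq (fun t => (1 - t) / 6)). intros t. auto_derive; exact I.
    + apply (continuous_mult (fun s => 2 / 3 * par s) (fun s => h (par s))); [|exact Hc].
      apply (Hq (fun t => 2 / 3 * t)). intros t. auto_derive; exact I.
    + apply (continuous_mult (fun s => par s * (1 - par s)) (fun s => dh (par s))); [|exact Hd].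
      apply (Hq (fun t => t * (1 - t))). intros t. auto_derive; exact I.
Qed.

(** * Moments of the weight *)

Lemma is_RInt_ext_unique (f g : R -> R) (a b l m : R) :
  (forall s, f s = g s) -> is_RInt f a b l -> is_RInt g a b m -> l = m.
Proof.
  intros He Hf Hg.
  apply (is_RInt_unique (V := R_CompleteNormedModule)) in Hf, Hg.
  rewrite <- Hf, <- Hg. apply RInt_ext. intros; apply He.
Qed.

(** This is [B(j + 1/6, 5/3)]: the factor [1 - par s] raises the exponent -1/3 of [1-t] carried by
    [wgt] to 2/3. *)
Definition moment (j : nat) : R := RInt (fun s => wgt s * (par s ^ j * (1 - par s))) 0 1.

Lemma ex_RInt_wgt (g : R -> R) :
  (forall t, ex_derive g t) -> ex_RInt (fun s => wgt s * g (par s)) 0 1.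
Proof.
  intros Hg. apply (ex_RInt_continuous (V := R_CompleteNormedModule)). intros s _.
  apply (continuous_mult wgt (fun s => g (par s))); [apply continuous_wgt|].
  apply continuous_comp; [apply continuous_par|]. now apply (ex_derive_continuous (V := R_NormedModule)).
Qed.

Lemma is_RInt_moment (j : nat) :
  is_RInt (fun s => wgt s * (par s ^ j * (1 - par s))) 0 1 (moment j).
Proof.
  apply (RInt_correct (V := R_CompleteNormedModule)). apply (ex_RInt_wgt (fun t => t ^ j * (1 - t))).
  intros t. auto_derive; exact I.
Qed.

(** Integrate the exact form [d(t^(j+1/6) (1-t)^(5/3))], that is, [h = t^j (1-t)]; note that
    [1/6 + 5/3 = 11/6]. *)
Lemma moment_rec (j : nat) :
  (INR j + 1 / 6) * moment j = (INR j + 11 / 6) * moment (S j).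
Proof.
  assert (H := is_RInt_exact (fun t => t ^ j * (1 - t))
    (fun t => INR j * t ^ pred j * (1 - t) - t ^ j)).
  assert (H0 := H ltac:(intros t; auto_derive; [exact I|ring])
     ltac:(intros t; apply (ex_derive_continuous (V := R_NormedModule)); auto_derive; exact I)). clear H.
  assert (H1 := is_RInt_minus _ _ _ _ _ _
     (is_RInt_scal _ _ _ (INR j + 1 / 6) _ (is_RInt_moment j))
     (is_RInt_scal _ _ _ (INR j + 11 / 6) _ (is_RInt_moment (S j)))).
  apply Rminus_diag_uniq.
  refine (is_RInt_ext_unique _ _ _ _ _ _ _ H1 H0).
  intros s. unfold minus, plus, opp, scal; simpl. unfold mult; simpl.
  (* For [j = 0] the exponent [pred j] is harmless because its coefficient [INR j] is 0. *)
  destruct j as [|j]; [simpl; field|].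
  rewrite S_INR. simpl pred. generalize (INR j) (wgt s) (par s); intros n w t.
  simpl. field.
Qed.

Lemma moment_pos (j : nat) : 0 < moment j.
Proof.
  unfold moment. apply RInt_gt_0; [lra| |].
  - intros s Hs. assert (H : 0 < s ^ 6 < 1).
    { split; [apply pow_lt; lra|]. apply pow_lt_1_compat; [lra|lia]. }
    apply Rmult_lt_0_compat; [|apply Rmult_lt_0_compat].
    + unfold wgt. pose proof (Rpower_pos (cof s) (- (5/6))). nra.
    + apply pow_lt. rewrite par_cof. apply Rmult_lt_0_compat; [lra|apply cof_pos].
    + unfold par. assert (0 < (1 - s ^ 6) ^ 3) by (apply pow_lt; lra). lra.
  - intros s _. apply (continuous_mult wgt (fun s => par s ^ j * (1 - par s))); [apply continuous_wgt|].
    apply (continuous_comp par (fun t => t ^ j * (1 - t))); [apply continuous_par|].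
    apply (ex_derive_continuous (V := R_NormedModule)). auto_derive; exact I.
Qed.

(** This is [B(1/6,2/3) = 5/4 B(1/6,5/3)]. With [h = 1] the exact integrand is [wgt * (1 - 5t)/6],
    and [5/4 (1-t) - 3/2 (1-5t)/6 = 1]. *)
Lemma is_RInt_wgt : is_RInt wgt 0 1 (5 / 4 * moment 0).
Proof.
  assert (H := is_RInt_exact (fun _ => 1) (fun _ => 0)
    ltac:(intros t; apply @is_derive_const) ltac:(intros t; apply continuous_const)).
  assert (H1 := is_RInt_plus _ _ _ _ _ _
     (is_RInt_scal _ _ _ (5/4) _ (is_RInt_moment 0))
     (is_RInt_scal _ _ _ (- (3/2)) _ H)).
  evar_last; [eapply is_RInt_ext; [|exact H1]|].
  - intros s _. unfold plus, scal; simpl. unfold mult; simpl. field.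
  - unfold plus, scal; simpl. unfold mult; simpl. ring.
Qed.

(** * The algebraic substitution and its smooth lift *)

Definition root4 (t : R) : R := sqrt (4 + t ^ 2).
Definition den (t : R) : R := t ^ 2 - t + 2 + (1 - t) * root4 t.

Lemma root4_pos (t : R) : 0 < root4 t.
Proof. apply sqrt_lt_R0. nra. Qed.

Lemma root4_sqr (t : R) : root4 t ^ 2 = 4 + t ^ 2.
Proof. apply pow2_sqrt. nra. Qed.

Lemma is_derive_root4 (t : R) : is_derive root4 t (t / root4 t).
Proof.
  unfold root4. auto_derive; [nra|]. replace (t * (t * 1)) with (t ^ 2) by ring.
  field. apply Rgt_not_eq, root4_pos.
Qed.

(** Clear for [t <= 1]. For [t > 1] the conjugate in [root4 t] is positive, and its product with
    [den t] is [4 t]. *)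
Lemma den_pos (t : R) : 0 <= t -> 0 < den t.
Proof.
  intros Ht. unfold den.
  assert (Hq : 0 < t ^ 2 - t + 2) by nra.
  assert (Hr := root4_pos t).
  assert (E : (t ^ 2 - t + 2 + (1 - t) * root4 t) * (t ^ 2 - t + 2 - (1 - t) * root4 t) = 4 * t).
  { transitivity ((t ^ 2 - t + 2) ^ 2 - (1 - t) ^ 2 * root4 t ^ 2); [ring|].
    rewrite root4_sqr. ring. }
  destruct (Rle_lt_dec t 1) as [H|H]; [nra|].
  assert (0 < t ^ 2 - t + 2 - (1 - t) * root4 t) by nra. nra.
Qed.

(* [den t] is the larger root of [X^2 - 2 (t^2 - t + 2) X + 4 t], so that
   [z = 4 t / den t ^ 2] satisfies [z / (1 + z)^2 = t / (t^2 - t + 2)^2]. *)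
Lemma den_quadratic (t : R) : den t ^ 2 - 4 * t = 2 * (1 - t) * root4 t * den t.
Proof.
  unfold den. apply Rminus_diag_uniq.
  transitivity ((t ^ 2 - t + 2) ^ 2 - 4 * t - (1 - t) ^ 2 * root4 t ^ 2); [ring|].
  rewrite root4_sqr. ring.
Qed.

Lemma is_derive_den (t : R) :
  is_derive den t (2 * t - 1 - root4 t + (1 - t) * (t / root4 t)).
Proof.
  unfold den.
  assert (H := is_derive_root4 t).
  auto_derive; [now exists (t / root4 t)|]. replace (Derive _ t) with (t / root4 t) by (symmetry; exact (is_derive_unique _ _ _ H)). ring.
Qed.

Definition zmap (t : R) : R := 4 * t / den t ^ 2.

Lemma is_derive_zmap (t : R) :
  0 <= t -> is_derive zmap t (4 * (2 + 3 * t) / (den t ^ 2 * root4 t)).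
Proof.
  intros Ht. assert (Hd := is_derive_den t). assert (Hp := den_pos t Ht).
  assert (Hr := root4_pos t).
  unfold zmap. auto_derive.
  { split; [eexists; exact Hd|]. split; [|exact I].
    apply Rmult_integral_contrapositive; split; lra. }
  replace (Derive _ t) with (2 * t - 1 - root4 t + (1 - t) * (t / root4 t))
    by (symmetry; exact (is_derive_unique _ _ _ Hd)).
  (* The quotient rule leaves [den t ^ 3] below; this identity, valid modulo
     [root4 t ^ 2 = 4 + t ^ 2], cancels one factor [den t]. *)
  assert (E : (root4 t * den t - 2 * t * (root4 t * (2 * t - 1 - root4 t) + (1 - t) * t))
              = (2 + 3 * t) * den t).
  { unfold den. apply Rminus_diag_uniq.
    transitivity ((1 + t) * (root4 t ^ 2 - (4 + t ^ 2))); [ring|]. rewrite root4_sqr. ring. }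
  apply Rmult_eq_reg_r with (den t ^ 3 * root4 t);
   [|apply Rgt_not_eq, Rmult_lt_0_compat; [apply pow_lt|]; lra].
  transitivity (4 * (root4 t * den t - 2 * t * (root4 t * (2 * t - 1 - root4 t) + (1 - t) * t))).
  { field. lra. }
  rewrite E. field. lra.
Qed.

(* With [z = zmap (par s)], [croot s] is [(1-z)^(1/3)] and [lift s] is the [u] with [par u = z],
   written so that smoothness at [s = 0] and [s = 1] is visible. *)
Definition croot (s : R) : R :=
  (1 - s ^ 6) * Rpower (2 * root4 (par s) / den (par s)) (1 / 3).
Definition lift (s : R) : R :=
  s * Rpower (4 * cof s / (den (par s) ^ 2 * (1 + croot s + croot s ^ 2))) (1 / 6).

Lemma Rpower_root_pow (x : R) (n : nat) :
  0 < x -> (0 < n)%nat -> Rpower x (1 / INR n) ^ n = x.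
Proof.
  intros Hx Hn. rewrite <- Rpower_pow by apply Rpower_pos. rewrite Rpower_mult.
  replace (1 / INR n * INR n) with 1; [now apply Rpower_1|].
  field. apply not_0_INR. lia.
Qed.

Lemma Rpower_ratio_pow (x : R) : 0 < x ->
  Rpower x (1 / 3) ^ 3 = x /\ Rpower x (1 / 6) ^ 6 = x.
Proof.
  intros Hx. split.
  - replace 3 with (INR 3) by (simpl; ring). apply Rpower_root_pow; [exact Hx|lia].
  - replace 6 with (INR 6) by (simpl; ring). apply Rpower_root_pow; [exact Hx|lia].
Qed.

Lemma par_nonneg (s : R) : 0 <= par s.
Proof.
  rewrite par_cof. apply Rmult_le_pos; [|apply Rlt_le, cof_pos].
  replace (s ^ 6) with ((s ^ 3) ^ 2) by ring. apply pow2_ge_0.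
Qed.

Lemma den_par_pos (s : R) : 0 < den (par s).
Proof. apply den_pos, par_nonneg. Qed.

Lemma one_plus_sqr_pos (c : R) : 0 < 1 + c + c ^ 2.
Proof. nra. Qed.

Lemma ratio_pos (s : R) : 0 < 2 * root4 (par s) / den (par s).
Proof.
  pose proof (root4_pos (par s)). pose proof (den_par_pos s).
  apply Rdiv_lt_0_compat; lra.
Qed.

Lemma lift_base_pos (s : R) :
  0 < 4 * cof s / (den (par s) ^ 2 * (1 + croot s + croot s ^ 2)).
Proof.
  pose proof (cof_pos s). apply Rdiv_lt_0_compat; [lra|].
  apply Rmult_lt_0_compat; [apply pow_lt, den_par_pos|apply one_plus_sqr_pos].
Qed.

(** By [den_quadratic], [1 - z = 2 (1-t) root4 t / den t], and [1-t = (1-s^6)^3] is already a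
    cube. *)
Lemma croot_cube (s : R) : croot s ^ 3 = 1 - zmap (par s).
Proof.
  unfold croot, zmap. rewrite Rpow_mult_distr, (proj1 (Rpower_ratio_pow _ (ratio_pos s))).
  assert (Hd := den_par_pos s).
  replace ((1 - s ^ 6) ^ 3) with (1 - par s) by (unfold par; ring).
  apply Rmult_eq_reg_r with (den (par s) ^ 2); [|apply Rgt_not_eq, pow_lt; lra].
  transitivity (2 * (1 - par s) * root4 (par s) * den (par s)); [field; lra|].
  rewrite <- den_quadratic. field. lra.
Qed.

(** With [c = croot s], [z = 1 - c^3 = (1-c)(1+c+c^2)], while [z = 4 s^6 cof s / den^2]; dividing by
    [1+c+c^2] gives the sixth power of [lift s]. *)
Lemma lift_pow6 (s : R) : lift s ^ 6 = 1 - croot s.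
Proof.
  unfold lift. rewrite Rpow_mult_distr, (proj2 (Rpower_ratio_pow _ (lift_base_pos s))).
  assert (Hd := den_par_pos s). assert (Hc := one_plus_sqr_pos (croot s)).
  transitivity (zmap (par s) / (1 + croot s + croot s ^ 2)).
  - transitivity (4 * (s ^ 6 * cof s) / (den (par s) ^ 2 * (1 + croot s + croot s ^ 2)));
      [field; lra|].
    rewrite <- par_cof. unfold zmap. field. lra.
  - apply Rmult_eq_reg_r with (1 + croot s + croot s ^ 2); [|lra].
    transitivity (1 - (1 - zmap (par s))); [field; lra|].
    rewrite <- croot_cube. ring.
Qed.

Lemma par_lift (s : R) : par (lift s) = zmap (par s).
Proof.
  unfold par at 1. rewrite lift_pow6.
  replace (1 - (1 - croot s)) with (croot s) by ring. rewrite croot_cube. ring.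
Qed.

Lemma ex_derive_lift (s : R) : ex_derive lift s.
Proof.
  assert (Hpar : ex_derive par s) by (eexists; apply is_derive_par).
  assert (Hcof : ex_derive cof s) by (unfold cof; auto_derive; exact I).
  assert (Hroot : ex_derive (fun s => root4 (par s)) s).
  { apply (ex_derive_comp root4 par); [eexists; apply is_derive_root4|exact Hpar]. }
  assert (Hden : ex_derive (fun s => den (par s)) s).
  { apply (ex_derive_comp den par); [eexists; apply is_derive_den|exact Hpar]. }
  assert (Hd := den_par_pos s). assert (Hc := one_plus_sqr_pos (croot s)).
  assert (Hcroot : ex_derive croot s).
  { unfold croot. apply ex_derive_mult; [auto_derive; exact I|].
    apply ex_derive_Rpower_comp; [apply ratio_pos|].
    apply (ex_derive_div (fun s => 2 * root4 (par s)) (fun s => den (par s))).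
    - apply ex_derive_mult; [apply @ex_derive_const|exact Hroot].
    - exact Hden.
    - lra. }
  unfold lift. apply ex_derive_mult; [apply @ex_derive_id|].
  apply ex_derive_Rpower_comp; [apply lift_base_pos|].
  apply (ex_derive_div (fun s => 4 * cof s)
           (fun s => den (par s) ^ 2 * (1 + croot s + croot s ^ 2))).
  - apply ex_derive_mult; [apply @ex_derive_const|exact Hcof].
  - apply (ex_derive_mult (fun s => den (par s) ^ 2) (fun s => 1 + croot s + croot s ^ 2)).
    + apply (ex_derive_pow (fun s => den (par s)) 2 s Hden).
    + apply @ex_derive_plus; [|apply (ex_derive_pow croot 2 s Hcroot)].
      apply @ex_derive_plus; [apply @ex_derive_const|exact Hcroot].
  - apply Rgt_not_eq, Rmult_lt_0_compat; [apply pow_lt|]; lra.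
Qed.

(** * Transport of the weight along the substitution *)

(** Used with [x = s], [y = cof s], so that [x^6 y = par s]: it trades the power of [cof] in [wgt]
    for a power of [par]. *)
Lemma Rpower_split_pow6 (x y : R) : 0 < x -> 0 < y ->
  Rpower y (- (5 / 6)) = x ^ 5 * Rpower (x ^ 6 * y) (- (5 / 6)).
Proof.
  intros Hx Hy. rewrite <- Rpower_mult_distr by (try apply pow_lt; assumption).
  rewrite <- (Rpower_pow 6 x), <- (Rpower_pow 5 x) by exact Hx.
  rewrite Rpower_mult, <- Rmult_assoc, <- Rpower_plus.
  replace (INR 5 + INR 6 * - (5 / 6)) with 0 by (simpl; field).
  rewrite Rpower_O by exact Hx. ring.
Qed.

(** Both sides are monomials in 2, [t], [q], [r], so it suffices to compare exponents after taking
    logarithms. It is applied with [q = den t] and [r = root4 t]. *)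
Lemma Rpower_zmap (t q r : R) : 0 < t -> 0 < q -> 0 < r ->
  Rpower (2 * r / q) (1 / 3) * Rpower t (- (5 / 6)) * Rpower (r ^ 2) (- (2 / 3)) * (q ^ 2 * r)
  = 4 * Rpower (4 * t / q ^ 2) (- (5 / 6)).
Proof.
  intros Ht Hq Hr.
  replace 4 with (2 * 2) by ring.
  assert (H2 := exp_ln 2 ltac:(lra)).
  rewrite <- (exp_ln t Ht), <- (exp_ln q Hq), <- (exp_ln r Hr).
  revert H2. generalize (ln t) (ln q) (ln r) (ln 2). intros a b c d H2.
  rewrite <- H2.
  replace (exp b ^ 2) with (exp (b + b)) by (rewrite exp_plus; ring).
  replace (exp c ^ 2) with (exp (c + c)) by (rewrite exp_plus; ring).
  unfold Rdiv at 1 5. rewrite <- !exp_Ropp, <- !exp_plus.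
  unfold Rpower. rewrite !ln_exp, <- !exp_plus, H2. f_equal. field.
Qed.

(* The identity [z^(-5/6) (1-z)^(-1/3) dz
   = (2+3t) (4+t^2)^(-2/3) t^(-5/6) (1-t)^(-1/3) dt] read in the variables
   [s] and [lift s], where [t = par s] and [z = par (lift s)]. *)
Lemma wgt_lift (s du : R) : 0 < s < 1 -> is_derive lift s du ->
  wgt (lift s) * du = wgt s * ((2 + 3 * par s) * Rpower (4 + par s ^ 2) (- (2 / 3))).
Proof.
  intros Hs Hdu.
  assert (Hs6 : 0 < 1 - s ^ 6).
  { assert (s ^ 6 < 1) by (apply pow_lt_1_compat; [lra|lia]). lra. }
  assert (Hu : 0 < lift s) by (apply Rmult_lt_0_compat; [lra|apply Rpower_pos]).
  assert (Hc : 0 < croot s) by (apply Rmult_lt_0_compat; [lra|apply Rpower_pos]).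
  assert (Hcu : 1 - lift s ^ 6 = croot s) by (rewrite lift_pow6; ring).
  assert (Ht : 0 < par s).
  { rewrite par_cof. apply Rmult_lt_0_compat; [apply pow_lt; lra|apply cof_pos]. }
  assert (Hq := den_par_pos s). assert (Hr := root4_pos (par s)).
  (* Differentiate [par (lift s) = zmap (par s)] by the chain rule on each side. *)
  assert (E : 18 * lift s ^ 5 * croot s ^ 2 * du =
     4 * (2 + 3 * par s) / (den (par s) ^ 2 * root4 (par s)) * (18 * s ^ 5 * (1 - s ^ 6) ^ 2)).
  { assert (H1 := is_derive_comp par lift s _ _ (is_derive_par (lift s)) Hdu).
    assert (H2 := is_derive_comp zmap par s _ _ (is_derive_zmap _ (par_nonneg s)) (is_derive_par s)).
    apply (is_derive_ext _ _ _ _ par_lift) in H1.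
    apply is_derive_unique in H1. apply is_derive_unique in H2.
    assert (H3 := eq_trans (eq_sym H1) H2).
    unfold scal in H3; simpl in H3. unfold mult in H3; simpl in H3.
    rewrite <- Hcu. simpl. lra. }
  assert (Hz := Rpower_zmap _ _ _ Ht Hq Hr).
  rewrite root4_sqr in Hz.
  unfold wgt. rewrite Hcu.
  rewrite (Rpower_split_pow6 (lift s)) by (exact Hu || apply cof_pos).
  rewrite (Rpower_split_pow6 s (cof s)) by (lra || apply cof_pos).
  rewrite <- !par_cof, par_lift. unfold zmap.
  (* The extra factor completes the [croot s ^ 2] that occurs in [E]. *)
  apply Rmult_eq_reg_l with (croot s); [|lra].
  transitivity (Rpower (4 * par s / den (par s) ^ 2) (- (5 / 6))
                * (18 * lift s ^ 5 * croot s ^ 2 * du)); [ring|].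
  rewrite E. unfold croot.
  transitivity (4 * Rpower (4 * par s / den (par s) ^ 2) (- (5 / 6))
    * ((2 + 3 * par s) * (18 * s ^ 5 * (1 - s ^ 6) ^ 2)) / (den (par s) ^ 2 * root4 (par s)));
    [field; lra|].
  rewrite <- Hz. field. lra.
Qed.

(** Substitute [lift s], which fixes 0 and 1, in [is_RInt_wgt]. *)
Lemma is_RInt_wgt_lift :
  is_RInt (fun s => wgt s * ((2 + 3 * par s) * Rpower (4 + par s ^ 2) (- (2 / 3)))) 0 1
    (5 / 4 * moment 0).
Proof.
  set (g := fun t => (2 + 3 * t) * Rpower (4 + t ^ 2) (- (2 / 3))).
  assert (Hg : forall t, ex_derive g t).
  { intros t. apply ex_derive_mult; [auto_derive; exact I|].
    apply ex_derive_Rpower_comp; [nra|]. auto_derive; exact I. }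
  assert (Hf : forall s, continuous (fun s => wgt s * g (par s)) s).
  { intros s. apply (continuous_mult wgt (fun s => g (par s))); [apply continuous_wgt|].
    apply continuous_comp; [apply continuous_par|].
    now apply (ex_derive_continuous (V := R_NormedModule)). }
  assert (HI : forall f : R -> R, (forall s, continuous f s) ->
     forall x, is_derive (fun x => RInt f 0 x) x (f x)).
  { intros f Hc x. apply (is_derive_RInt f _ 0 x); [|apply Hc].
    apply filter_forall. intros y. apply (RInt_correct (V := R_CompleteNormedModule)).
    apply (ex_RInt_continuous (V := R_CompleteNormedModule)). intros z _. apply Hc. }
  set (f := fun s => wgt s * g (par s)) in *.
  (* The difference of the two antiderivatives: [wgt_lift] makes its derivative vanish on the open
     interval, so the mean value theorem gives [F 1 = F 0]. *)
  set (F := fun s => RInt wgt 0 (lift s) - RInt f 0 s).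
  assert (HF : forall s, is_derive F s (wgt (lift s) * Derive lift s - f s)).
  { intros s. evar_last.
    - apply (is_derive_minus (fun s => RInt wgt 0 (lift s)) (fun s => RInt f 0 s)).
      + apply (is_derive_comp (fun x => RInt wgt 0 x) lift).
        * apply HI, continuous_wgt.
        * apply Derive_correct, ex_derive_lift.
      + apply HI, Hf.
    - unfold minus, plus, opp, scal; simpl. unfold mult; simpl. ring. }
  assert (HE : F 1 = F 0).
  { destruct (MVT_gen F 0 1 (fun _ => 0)) as [c [_ Hc]].
    - rewrite Rmin_left, Rmax_right by lra. intros s Hs.
      replace 0 with (wgt (lift s) * Derive lift s - f s); [apply HF|].
      rewrite (wgt_lift s (Derive lift s) Hs); [unfold f, g; ring|].
      apply Derive_correct, ex_derive_lift.
    - intros s _. apply continuity_pt_filterlim.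
      apply (ex_derive_continuous (V := R_NormedModule)). eexists. apply HF.
    - lra. }
  assert (L0 : lift 0 = 0) by (unfold lift; ring).
  assert (L1 : lift 1 = 1).
  { assert (H6 := lift_pow6 1).
    assert (Hp : 0 < lift 1) by (apply Rmult_lt_0_compat; [lra|apply Rpower_pos]).
    replace (croot 1) with 0 in H6 by (unfold croot; ring).
    destruct (Rtotal_order (lift 1) 1) as [H|[H|H]]; [|exact H|].
    - assert (lift 1 ^ 6 < 1) by (apply pow_lt_1_compat; [lra|lia]). lra.
    - assert (1 < lift 1 ^ 6) by (apply Rlt_pow_R1; [lra|lia]). lra. }
  unfold F in HE. rewrite L0, L1 in HE.
  rewrite !RInt_point in HE. rewrite (is_RInt_unique _ _ _ _ is_RInt_wgt) in HE.
  replace (5 / 4 * moment 0) with (RInt f 0 1)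
    by (unfold zero in HE; simpl in HE; lra).
  apply (RInt_correct (V := R_CompleteNormedModule)). apply (ex_RInt_wgt g Hg).
Qed.

(** * The binomial series of [(1-x)^(-b)] *)

Definition binom_coeff (b : R) (k : nat) : R := pochhammer b k / pochhammer 1 k.

Lemma pochhammer_pos (a : R) (k : nat) : 0 < a -> 0 < pochhammer a k.
Proof.
  intros Ha. induction k as [|k IH]; simpl; [lra|].
  apply Rmult_lt_0_compat; [exact IH|]. pose proof (pos_INR k). lra.
Qed.

Lemma binom_coeff_succ (b : R) (k : nat) :
  INR (S k) * binom_coeff b (S k) = (b + INR k) * binom_coeff b k.
Proof.
  unfold binom_coeff. rewrite S_INR. simpl pochhammer.
  assert (H := pochhammer_pos 1 k ltac:(lra)). pose proof (pos_INR k). field. lra.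
Qed.

Lemma binom_coeff_bound (b : R) (k : nat) : 0 < b <= 1 -> 0 < binom_coeff b k <= 1.
Proof.
  intros Hb. induction k as [|k IH]; [unfold binom_coeff; simpl; lra|].
  assert (H := binom_coeff_succ b k). rewrite S_INR in H. pose proof (pos_INR k).
  split; nra.
Qed.

Lemma binom_CV_radius (b x : R) : 0 < b <= 1 -> Rabs x < 1 ->
  Rbar_lt (Rabs x) (CV_radius (binom_coeff b)).
Proof.
  intros Hb Hx. apply Rbar_lt_le_trans with 1; [exact Hx|].
  apply (proj1 (CV_radius_bounded (binom_coeff b))). exists 1. intros k.
  assert (H := binom_coeff_bound b k Hb). rewrite pow1, Rmult_1_r, Rabs_pos_eq; lra.
Qed.

(** The coefficient recurrence, read as the differential equation [(1-x) f' = b f]. *)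
Lemma binom_PS_derive (b x : R) : 0 < b <= 1 -> Rabs x < 1 ->
  PSeries (PS_derive (binom_coeff b)) x =
  b * PSeries (binom_coeff b) x + x * PSeries (PS_derive (binom_coeff b)) x.
Proof.
  intros Hb Hx. assert (HR := binom_CV_radius b x Hb Hx).
  assert (HD : ex_pseries (PS_derive (binom_coeff b)) x)
    by (apply CV_radius_inside; now rewrite CV_radius_derive).
  rewrite <- PSeries_incr_1, <- PSeries_scal, <- PSeries_plus.
  - apply PSeries_ext. intros k. unfold PS_derive at 1. rewrite binom_coeff_succ.
    unfold PS_plus, PS_scal, PS_incr_1, plus, scal; simpl. unfold mult; simpl.
    destruct k as [|k]; [simpl; unfold zero; simpl; ring|].
    unfold PS_derive. simpl. ring.
  - apply ex_pseries_scal; [apply Rmult_comm|now apply CV_radius_inside].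
  - now apply ex_pseries_incr_1.
Qed.

(** By the differential equation, [f(x) (1-x)^b] has derivative zero; its value at 0 is 1. *)
Lemma PSeries_binom (b x : R) : 0 < b <= 1 -> Rabs x < 1 ->
  PSeries (binom_coeff b) x = Rpower (1 - x) (- b).
Proof.
  intros Hb Hx.
  set (f := PSeries (binom_coeff b)).
  set (F := fun y => f y * Rpower (1 - y) b).
  assert (HF : forall y, Rabs y < 1 -> is_derive F y 0).
  { intros y Hy. assert (Hy1 : 0 < 1 - y) by (apply Rabs_def2 in Hy; lra).
    evar_last.
    - apply (is_derive_mult f (fun y => Rpower (1 - y) b)).
      + apply is_derive_PSeries. now apply binom_CV_radius.
      + apply (is_derive_Rpower_comp (fun y => 1 - y) (-1)); [exact Hy1|].
        auto_derive; [exact I|ring].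
      + apply Rmult_comm.
    - unfold plus, mult; simpl.
      assert (E := binom_PS_derive b y Hb Hy).
      replace (Rpower (1 - y) b) with ((1 - y) * Rpower (1 - y) (b - 1))
        by (rewrite <- Rpower_succ by exact Hy1; f_equal; ring).
      fold (f y) in E |- *. revert E. generalize (PSeries (PS_derive (binom_coeff b)) y).
      intros df E.
      transitivity (Rpower (1 - y) (b - 1) * (df - (b * f y + y * df))); [ring|].
      rewrite <- E. ring. }
  assert (HE : F x = F 0).
  { assert (Hr : forall c, Rmin 0 x <= c <= Rmax 0 x -> Rabs c < 1).
    { intros c Hc. apply Rabs_def2 in Hx. apply Rabs_def1.
      - apply Rle_lt_trans with (Rmax 0 x); [lra|]. apply Rmax_lub_lt; lra.
      - apply Rlt_le_trans with (Rmin 0 x); [|lra]. apply Rmin_glb_lt; lra. }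
    destruct (MVT_gen F 0 x (fun _ => 0)) as [c [_ Hc]].
    - intros y Hy. apply HF, Hr. lra.
    - intros y Hy. apply continuity_pt_filterlim.
      apply (ex_derive_continuous (V := R_NormedModule)). eexists. now apply HF, Hr.
    - lra. }
  unfold F in HE. rewrite Rminus_0_r in HE.
  unfold f in HE at 2. rewrite PSeries_0 in HE.
  replace (Rpower 1 b) with 1 in HE
    by (unfold Rpower; rewrite ln_1, Rmult_0_r, exp_0; reflexivity).
  unfold binom_coeff in HE; simpl in HE. fold (binom_coeff b) in HE.
  rewrite Rpower_Ropp. pose proof (Rpower_pos (1 - x) b).
  apply Rmult_eq_reg_r with (Rpower (1 - x) b); [|lra]. rewrite HE. field. lra.
Qed.

(** The factor [INR k] turns [f] into [x f'], and [f' = b f / (1-x)]. *)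
Lemma is_series_binom_linear (b x p q : R) : 0 < b <= 1 -> Rabs x < 1 ->
  is_series (fun k => binom_coeff b k * (p * INR k + q) * x ^ k)
    (Rpower (1 - x) (- b) * (q + p * (b * x / (1 - x)))).
Proof.
  intros Hb Hx. assert (HR := binom_CV_radius b x Hb Hx).
  assert (Hx1 : 0 < 1 - x) by (apply Rabs_def2 in Hx; lra).
  assert (H0 := PSeries_correct _ _ (CV_radius_inside _ _ HR)).
  assert (HD : ex_pseries (PS_derive (binom_coeff b)) x)
    by (apply CV_radius_inside; now rewrite CV_radius_derive).
  assert (H1 := is_pseries_incr_1 _ _ _ (PSeries_correct _ _ HD)).
  assert (E := binom_PS_derive b x Hb Hx).
  rewrite PSeries_binom in H0, E by assumption.
  replace (PSeries (PS_derive (binom_coeff b)) x)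
    with (b * Rpower (1 - x) (- b) / (1 - x)) in H1
    by (apply Rmult_eq_reg_r with (1 - x); [field_simplify; lra|lra]).
  apply is_pseries_R in H0, H1.
  assert (H2 := is_series_plus _ _ _ _ (is_series_scal q _ _ H0) (is_series_scal p _ _ H1)).
  evar_last; [eapply is_series_ext; [|exact H2]|].
  - intros k. unfold plus, scal; simpl. unfold mult; simpl.
    destruct k as [|k]; [simpl; unfold zero; simpl; ring|].
    unfold PS_incr_1, PS_derive. ring.
  - unfold plus, scal; simpl. unfold mult; simpl. field. lra.
Qed.

(** * Generating function of the coefficients: tail bound and integral *)

(** The summand of the theorem without the Pochhammer quotient that equals
    [moment (2 * k) / moment 0]. *)
Definition coeff (k : nat) : R := (- (1 / 4)) ^ k * binom_coeff (2 / 3) k * (60 * INR k + 13).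
Definition gen (t : R) : R :=
  Rpower 4 (2 / 3) * Rpower (4 + t ^ 2) (- (2 / 3)) * ((52 - 27 * t ^ 2) / (4 + t ^ 2)).

(** Binomial series with [b = 2/3], [x = -t^2/4]; the linear factor contributes [13 + 40 x/(1-x) =
    (52 - 27 t^2)/(4 + t^2)]. *)
Lemma is_series_gen (t : R) : 0 <= t <= 1 ->
  is_series (fun k => coeff k * t ^ (2 * k)) (gen t).
Proof.
  intros Ht.
  assert (Hx : Rabs (- (t ^ 2 / 4)) < 1) by (apply Rabs_def1; nra).
  assert (H := is_series_binom_linear (2 / 3) (- (t ^ 2 / 4)) 60 13 ltac:(lra) Hx).
  evar_last; [eapply is_series_ext; [|exact H]|].
  - intros k. unfold coeff. rewrite pow_mult.
    replace (- (t ^ 2 / 4)) with (- (1 / 4) * t ^ 2) by field.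
    rewrite Rpow_mult_distr. simpl. ring.
  - unfold gen.
    replace (1 - - (t ^ 2 / 4)) with (/ 4 * (4 + t ^ 2)) by field.
    rewrite <- Rpower_mult_distr by nra.
    replace (Rpower (/ 4) (- (2 / 3))) with (Rpower 4 (2 / 3))
      by (unfold Rpower; rewrite ln_Rinv by lra; f_equal; ring).
    field. nra.
Qed.

(** Split [4^(-k)] as [2^(-k) 2^(-k)]; one factor absorbs [60 k + 13 <= 73 (k+1) <= 73 * 2^k]. *)
Lemma coeff_bound (k : nat) (t : R) : 0 <= t <= 1 ->
  Rabs (coeff k * t ^ (2 * k)) <= 73 * (1 / 2) ^ k.
Proof.
  intros Ht. unfold coeff. rewrite !Rabs_mult, <- !RPow_abs, Rabs_Ropp.
  assert (Hb := binom_coeff_bound (2 / 3) k ltac:(lra)).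
  rewrite (Rabs_pos_eq (1 / 4)), (Rabs_pos_eq t), (Rabs_pos_eq (binom_coeff _ _)) by lra.
  pose proof (pos_INR k). rewrite (Rabs_pos_eq (60 * _ + _)) by lra.
  assert (Hk : INR k + 1 <= 2 ^ k).
  { clear. induction k as [|k IH]; [simpl; lra|]. rewrite S_INR. simpl.
    pose proof (pos_INR k). lra. }
  assert (Hp : 0 <= t ^ (2 * k) <= 1).
  { split; [apply pow_le; lra|]. rewrite <- (pow1 (2 * k)). apply pow_incr; lra. }
  replace (1 / 4) with (1 / 2 * (1 / 2)) by field. rewrite Rpow_mult_distr.
  assert (H2 : (1 / 2) ^ k * 2 ^ k = 1).
  { rewrite <- Rpow_mult_distr. replace (1 / 2 * 2) with 1 by field. apply pow1. }
  assert (Hh : 0 < (1 / 2) ^ k) by (apply pow_lt; lra).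
  revert Hh H2 Hk Hp Hb. generalize ((1 / 2) ^ k) (2 ^ k) (t ^ (2 * k)) (binom_coeff (2/3) k).
  intros h w y c Hh H2 Hk Hp Hb.
  assert (Hhn : h * (60 * INR k + 13) <= 73) by nra.
  assert (Hhn0 : 0 <= h * (60 * INR k + 13)) by nra.
  assert (Hcy : 0 <= c * y <= 1) by nra.
  replace (h * h * c * (60 * INR k + 13) * y) with (h * (h * (60 * INR k + 13) * (c * y))) by ring.
  replace (73 * h) with (h * (73 * 1)) by ring.
  apply Rmult_le_compat_l; [lra|]. apply Rmult_le_compat; lra.
Qed.

Lemma series_tail_geom (u : nat -> R) (l C : R) (N : nat) :
  is_series u l -> (forall k, Rabs (u k) <= C * (1 / 2) ^ k) ->
  Rabs (l - sum_n u N) <= C * (1 / 2) ^ N.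
Proof.
  intros Hl Hu.
  assert (HC : 0 <= C).
  { eapply Rle_trans; [apply Rabs_pos|]. specialize (Hu 0%nat). simpl in Hu.
    rewrite Rmult_1_r in Hu. exact Hu. }
  (* The subtracted term makes the induction close, as the geometric bounds telescope; it is dropped
     before letting [n] tend to infinity. *)
  assert (H : forall n, Rabs (sum_n u (n + N) - sum_n u N) <= C * (1 / 2) ^ N - C * (1 / 2) ^ (n + N)).
  { induction n as [|n IH]; [change (0 + N)%nat with N; rewrite !Rminus_diag, Rabs_R0; apply Rle_refl|].
    change (S n + N)%nat with (S (n + N)). rewrite sum_Sn. unfold plus; simpl.
    replace (sum_n u (n + N) + u (S (n + N)) - sum_n u N)
      with (sum_n u (n + N) - sum_n u N + u (S (n + N))) by ring.
    eapply Rle_trans; [apply Rabs_triang|].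
    specialize (Hu (S (n + N))). simpl pow in Hu |- *. lra. }
  apply (is_lim_seq_le (fun n => Rabs (sum_n u (n + N) - sum_n u N)) (fun _ => C * (1 / 2) ^ N)
    (Rabs (l - sum_n u N)) (C * (1 / 2) ^ N)).
  - intros n. eapply Rle_trans; [apply H|].
    assert (0 <= C * (1 / 2) ^ (n + N)) by (apply Rmult_le_pos; [|apply pow_le]; lra). lra.
  - apply (is_lim_seq_abs _ (l - sum_n u N)). apply is_lim_seq_minus'; [|apply is_lim_seq_const].
    now apply (is_lim_seq_incr_n (sum_n u) N l).
  - apply is_lim_seq_const.
Qed.

(** Four times [is_RInt_wgt_lift] plus thirty times the exact form for [h = (4+t^2)^(-2/3)], all
    scaled by [4^(2/3)]. The integrands agree because [4(2+3t)(4+t^2) + 5(1-5t)(4+t^2) - 40t^2(1-t)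
    = (1-t)(52-27t^2)]. *)
Lemma is_RInt_gen :
  is_RInt (fun s => wgt s * (gen (par s) * (1 - par s))) 0 1
    (10 * Rpower 2 (1 / 3) * moment 0).
Proof.
  assert (H := is_RInt_exact (fun t => Rpower (4 + t ^ 2) (- (2 / 3)))
    (fun t => - (2 / 3) * (2 * t) * Rpower (4 + t ^ 2) (- (2 / 3) - 1))).
  assert (H0 := H
    ltac:(intros t; apply (is_derive_Rpower_comp (fun t => 4 + t ^ 2)); [nra|auto_derive; [exact I|ring]])
    ltac:(intros t; apply (ex_derive_continuous (V := R_NormedModule));
          apply ex_derive_mult; [auto_derive; exact I|];
          apply (ex_derive_Rpower_comp (fun t => 4 + t ^ 2)); [nra|auto_derive; exact I])). clear H.
  assert (H1 := is_RInt_scal _ _ _ (Rpower 4 (2 / 3)) _ (is_RInt_plus _ _ _ _ _ _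
     (is_RInt_scal _ _ _ 4 _ is_RInt_wgt_lift) (is_RInt_scal _ _ _ 30 _ H0))).
  evar_last; [eapply is_RInt_ext; [|exact H1]|].
  - intros s _. unfold gen, plus, scal; simpl. unfold mult; simpl.
    set (t := par s).
    replace (4 + t * (t * 1)) with (4 + t ^ 2) by ring.
    assert (Hp : 0 < 4 + t ^ 2) by nra.
    assert (E := Rpower_succ (4 + t ^ 2) (- (2 / 3) - 1) Hp).
    replace (- (2 / 3) - 1 + 1) with (- (2 / 3)) in E by ring. rewrite E.
    field. lra.
  - unfold plus, scal; simpl. unfold mult; simpl.
    replace (Rpower 4 (2 / 3)) with (2 * Rpower 2 (1 / 3)).
    + field.
    + rewrite <- Rpower_succ by lra. replace 4 with (2 ^ 2) by ring.
      rewrite <- (Rpower_pow 2 2), Rpower_mult by lra. f_equal. simpl. field.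
Qed.

(** * Termwise integration and conclusion *)

Lemma is_RInt_sum_n (a : nat -> R) (N : nat) :
  is_RInt (fun s => wgt s * (sum_n (fun k => a k * par s ^ (2 * k)) N * (1 - par s))) 0 1
    (sum_n (fun k => a k * moment (2 * k)) N).
Proof.
  assert (Hk : forall k, is_RInt (fun s => wgt s * (a k * par s ^ (2 * k) * (1 - par s))) 0 1
                           (a k * moment (2 * k))).
  { intros k. eapply is_RInt_ext; [|exact (is_RInt_scal _ _ _ (a k) _ (is_RInt_moment (2 * k)))].
    intros s _. unfold scal; simpl. unfold mult; simpl. ring. }
  induction N as [|N IH].
  - rewrite sum_O. eapply is_RInt_ext; [|exact (Hk 0%nat)].
    intros s _. simpl. now rewrite sum_O.
  - rewrite sum_Sn.
    eapply is_RInt_ext; [|exact (is_RInt_plus _ _ _ _ _ _ IH (Hk (S N)))].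
    intros s _. simpl. rewrite sum_Sn. unfold plus; simpl. ring.
Qed.

(** Two uses of [moment_rec] per step: [(2k+1/6)(2k+7/6) = 4(k+1/12)(k+7/12)], and likewise
    [(2k+11/6)(2k+17/6) = 4(k+11/12)(k+17/12)]. *)
Lemma moment_ratio (k : nat) :
  moment (2 * k) =
  pochhammer (1 / 12) k * pochhammer (7 / 12) k
  / (pochhammer (11 / 12) k * pochhammer (17 / 12) k) * moment 0.
Proof.
  induction k as [|k IH]; [simpl; field|].
  assert (H1 := moment_rec (2 * k)). assert (H2 := moment_rec (S (2 * k))).
  replace (2 * S k)%nat with (S (S (2 * k))) by lia.
  rewrite S_INR in H2. rewrite mult_INR in H1, H2. replace (INR 2) with 2 in H1, H2 by (simpl; ring).
  pose proof (pos_INR k).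
  assert (P1 := pochhammer_pos (11 / 12) k ltac:(lra)).
  assert (P2 := pochhammer_pos (17 / 12) k ltac:(lra)).
  assert (E : moment (S (S (2 * k))) =
    (INR k + 1 / 12) * (INR k + 7 / 12) / ((INR k + 11 / 12) * (INR k + 17 / 12)) * moment (2 * k)).
  { apply Rmult_eq_reg_l with ((2 * INR k + 1 + 11 / 6) * (2 * INR k + 11 / 6)); [|nra].
    transitivity ((2 * INR k + 11 / 6) * ((2 * INR k + 1 + 1 / 6) * moment (S (2 * k)))).
    { rewrite H2. ring. }
    transitivity ((2 * INR k + 1 + 1 / 6) * ((2 * INR k + 1 / 6) * moment (2 * k))).
    { rewrite H1. ring. }
    field. lra. }
  rewrite E, IH. simpl pochhammer. field. lra.
Qed.

Theorem mainTheorem10 :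
  is_series
    (fun k : nat =>
       (- (1 / 4)) ^ k *
       ((pochhammer (1 / 12) k * pochhammer (7 / 12) k * pochhammer (2 / 3) k) /
        (pochhammer (11 / 12) k * pochhammer 1 k * pochhammer (17 / 12) k)) *
       (60 * INR k + 13))
    (10 * Rpower 2 (1 / 3)).
Proof.
  assert (Hm := moment_pos 0).
  set (L := 10 * Rpower 2 (1 / 3) * moment 0).
  (* The tail bound is uniform in [t], so integrating it against the nonnegative weight justifies
     summation under the integral. *)
  assert (HN : forall N, Rabs (sum_n (fun k => coeff k * moment (2 * k)) N - L)
                 <= 73 * moment 0 * (1 / 2) ^ N).
  { intros N. rewrite Rabs_minus_sym.
    assert (H1 := is_RInt_minus _ _ _ _ _ _ is_RInt_gen (is_RInt_sum_n coeff N)).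
    assert (H2 := is_RInt_scal _ _ _ (73 * (1 / 2) ^ N) _ (is_RInt_moment 0)).
    replace (73 * moment 0 * (1 / 2) ^ N) with (scal (73 * (1 / 2) ^ N) (moment 0))
      by (unfold scal; simpl; unfold mult; simpl; ring).
    refine (norm_RInt_le _ _ 0 1 _ _ ltac:(lra) _ H1 H2).
    intros s Hs. simpl.
    assert (Ht := par_range s Hs). assert (Hw := wgt_nonneg s Hs).
    assert (Htail := series_tail_geom _ _ 73 N (is_series_gen _ Ht)
                       (fun k => coeff_bound k _ Ht)).
    unfold norm, minus, plus, opp, scal; simpl. unfold abs, mult; simpl.
    match goal with |- Rabs ?X <= _ =>
      replace X with (wgt s * (1 - par s)
        * (gen (par s) - sum_n (fun k => coeff k * par s ^ (2 * k)) N)) by (simpl; ring) end.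
    assert (Hw1 : 0 <= wgt s * (1 - par s)) by (apply Rmult_le_pos; lra).
    rewrite Rabs_mult, (Rabs_pos_eq _ Hw1).
    replace (73 * (1 / 2) ^ N * (wgt s * (1 * (1 - par s))))
      with (wgt s * (1 - par s) * (73 * (1 / 2) ^ N)) by ring.
    now apply Rmult_le_compat_l. }
  assert (Hlim : is_lim_seq (fun N => 73 * moment 0 * (1 / 2) ^ N) 0).
  { replace (Finite 0) with (Rbar_mult (73 * moment 0) 0) by (simpl; f_equal; ring).
    apply is_lim_seq_scal_l, is_lim_seq_geom. rewrite Rabs_pos_eq; lra. }
  assert (HS : is_series (fun k => coeff k * moment (2 * k)) L).
  { change (is_lim_seq (sum_n (fun k => coeff k * moment (2 * k))) L).
    apply is_lim_seq_ext with (fun N => (sum_n (fun k => coeff k * moment (2 * k)) N - L) + L).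
    { intros N. ring. }
    replace (Finite L) with (Finite (0 + L)) by (f_equal; ring).
    apply is_lim_seq_plus'; [|apply is_lim_seq_const].
    apply is_lim_seq_abs_0.
    apply (is_lim_seq_le_le (fun _ => 0) _ _ 0 (fun N => conj (Rabs_pos _) (HN N)));
      [apply is_lim_seq_const|exact Hlim]. }
  (* Division by [moment 0 > 0] turns the moments into the Pochhammer quotients. *)
  evar_last; [eapply is_series_ext; [|exact (is_series_scal (/ moment 0) _ _ HS)]|].
  - intros k. cbv beta. rewrite moment_ratio. unfold coeff, binom_coeff, scal; simpl. unfold mult; simpl.
    assert (P1 := pochhammer_pos (11 / 12) k ltac:(lra)).
    assert (P2 := pochhammer_pos (17 / 12) k ltac:(lra)).
    assert (P3 := pochhammer_pos 1 k ltac:(lra)).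
    field. lra.
  - unfold L, scal; simpl. unfold mult; simpl. field. lra.
Qed.
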